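(* Let $A$ be an abelian Banach algebra. If $A$ is a $C^*$-algebra or a uniform algebra, and $\Delta(A)$ is separable, then $A$ is $\ell_\infty$-embeddable. Moreover, if $A$ is a $C^*$-algebra, then the converse also holds (that is, if $A$ is $\ell_\infty$-embeddable then $\Delta(A)$ is separable).
   Context: Algebras are associative and complex; $\ell_\infty$ is the $C^*$-algebra of bounded complex sequences. $\Delta(A)$ is the set of nonzero multiplicative linear functionals on $A$ with the weak$^*$-topology; a topological space is separable if it has a countable dense subset. A uniform algebra is a commutative Banach algebra $A$ (not necessarily unital) with $\|a^2\|=\|a\|^2$ for all $a\in A$. $A$ is $\ell_\infty$-embeddable if there is an injective linear map $\phi\colon A\to\ell_\infty$ preserving the structure of $A$: an isometric algebra homomorphism if $A$ is a uniform algebra, a $^*$-homomorphism if $A$ is a $C^*$-algebra. *)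

(* Defs.v *)
From HB Require Import structures.
From mathcomp Require Import all_boot all_order all_algebra.
From mathcomp Require Import complex.
From mathcomp Require Import all_classical all_reals all_analysis.

Set Implicit Arguments.
Unset Strict Implicit.
Unset Printing Implicit Defensive.

Import Order.TTheory GRing.Theory Num.Theory.
Import numFieldNormedType.Exports.

Local Open Scope classical_set_scope.
Local Open Scope complex_scope.
Local Open Scope ring_scope.

(* numFieldNormedType covers abstract numeric fields only, so the instances on
   the concrete field R[i] have to be transported from R[i]^o. *)
HB.instance Definition _ (R : realType) := GRing.ComAlgebra.copy R[i] R[i]^o.
HB.instance Definition _ (R : realType) := Vector.copy R[i] R[i]^o.
HB.instance Definition _ (R : realType) := NormedModule.copy R[i] R[i]^o.

Reserved Notation "a ** b" (at level 40, left associativity).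

(* Algebras are not assumed unital, so MathComp's ring structures do not
   apply and the product is a separate operation. *)
HB.mixin Record isNormedAlgebra (R : realType) A of NormedModule R[i] A := {
  amul : A -> A -> A;
  amulA : associative amul;
  amulDl : left_distributive amul +%R;
  amulDr : right_distributive amul +%R;
  amulZl : forall (c : R[i]) (a b : A), amul (c *: a) b = c *: amul a b;
  amulZr : forall (c : R[i]) (a b : A), amul a (c *: b) = c *: amul a b;
  norm_amul : forall a b : A, `|amul a b| <= `|a| * `|b|
}.

#[short(type="normedAlgebraType")]
HB.structure Definition NormedAlgebra (R : realType) :=
  {A of NormedModule R[i] A & isNormedAlgebra R A}.

#[short(type="banachAlgebraType")]
HB.structure Definition BanachAlgebra (R : realType) :=
  {A of NormedAlgebra R A & CompleteNormedModule R[i] A}.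

Notation "a ** b" := (amul a b) : ring_scope.

Definition abelian_algebra (R : realType) (A : normedAlgebraType R) : Prop :=
  commutative (@amul R A).

Definition uniform_algebra (R : realType) (A : banachAlgebraType R) : Prop :=
  abelian_algebra A /\ forall a : A, `|a ** a| = `|a| ^+ 2.

(* A C*-algebra is a Banach algebra equipped with such a star. *)
Record cstar_involution (R : realType) (A : normedAlgebraType R)
    (star : A -> A) : Prop := {
  starK : involutive star;
  starD : {morph star : a b / a + b};
  starZ : forall (c : R[i]) (a : A), star (c *: a) = c^* *: star a;
  starM : forall a b : A, star (a ** b) = star b ** star a;
  norm_starM : forall a : A, `|star a ** a| = `|a| ^+ 2
}.

Definition separable_space (T : topologicalType) : Prop :=
  exists S : set T, countable S /\ dense S.

(* Characters of a Banach algebra are automatically bounded, so Delta A is a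
   subset of the dual of A, on which the weak* topology is that of pointwise
   convergence on A; [set_type (Delta A)] carries the subspace topology. *)
Definition Delta (R : realType) (A : banachAlgebraType R) :
    set {ptws A -> R[i]} :=
  [set phi | [/\ scalar phi, {morph phi : a b / a ** b >-> a * b}
              & exists a, phi a != 0]].

Arguments Delta {R} A.

Definition separable_Delta (R : realType) (A : banachAlgebraType R) : Prop :=
  separable_space (set_type (Delta A)).

Definition alg_hom (R : realType) (A B : normedAlgebraType R) (f : A -> B) :
    Prop :=
  linear f /\ {morph f : a b / a ** b}.

Section linf.
Variable R : realType.

Definition bounded_seq : {pred nat -> R[i]} :=
  fun u => `[< bounded_fun u >].

Lemma bounded_seqP (u : nat -> R[i]) :
  reflect (exists M : R[i], forall n, `|u n| <= M) (u \in bounded_seq).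
Proof.
rewrite unfold_in; apply: (iffP (asboolP _)) => [|[M uM]].
  by move=> /pinfty_ex_gt0[M _ uM]; exists M => n; exact: uM.
exists M; split; first by rewrite realE (le_trans _ (uM 0%N)).
by move=> x Mx n _; exact: le_trans (uM n) (ltW Mx).
Qed.

Lemma bounded_seq_submod : submod_closed bounded_seq.
Proof.
split=> [|c u v /bounded_seqP[M uM] /bounded_seqP[N vN]]; apply/bounded_seqP.
  by exists 0 => n; rewrite normr0.
exists (`|c| * M + N) => n.
by rewrite (le_trans (ler_normD _ _))// lerD// normrM ler_wpM2l.
Qed.

HB.instance Definition _ :=
  GRing.isSubmodClosed.Build R[i] (nat -> R[i]) bounded_seq bounded_seq_submod.

Record linf := Linf { linf_val :> nat -> R[i]; _ : linf_val \in bounded_seq }.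

HB.instance Definition _ := [isSub for linf_val].
HB.instance Definition _ := [Choice of linf by <:].
HB.instance Definition _ := [SubChoice_isSubLmodule of linf by <:].

Implicit Types u v : linf.

Lemma linfP u : exists M : R[i], forall n, `|u n| <= M.
Proof. by apply/bounded_seqP; case: u. Qed.

Lemma linfE u v : (forall n, u n = v n) -> u = v.
Proof. by move=> uv; apply/val_inj/funext. Qed.

Definition linf_norm u : R[i] := (sup (range (fun n => complex.Re `|u n|)))%:C.

Let ReK (z : R[i]) : 0 <= z -> (complex.Re z)%:C = z.
Proof. by move=> z0; apply: RRe_real; exact: ger0_real. Qed.

Let ler_Re (y z : R[i]) : y <= z -> complex.Re y <= complex.Re z.
Proof. by rewrite lecE => /andP[]. Qed.

Lemma linf_norm_ge u n : `|u n| <= linf_norm u.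
Proof.
have [M uM] := linfP u; rewrite -(ReK (normr_ge0 (u n))) lecR.
apply: ub_le_sup; last by exists n.
by exists (complex.Re M) => _ [m _ <-]; exact: ler_Re.
Qed.

Lemma linf_norm_le u (x : R[i]) : (forall n, `|u n| <= x) -> linf_norm u <= x.
Proof.
move=> ux; have x0 : 0 <= x := le_trans (normr_ge0 _) (ux 0%N).
rewrite -(ReK x0) lecR; apply: ge_sup.
  by exists (complex.Re `|u 0%N|), 0%N.
by move=> _ [n _ <-]; exact: ler_Re.
Qed.

Lemma linf_norm_ge0 u : 0 <= linf_norm u.
Proof. exact: le_trans (linf_norm_ge u 0%N). Qed.

Lemma linf_normD u v : linf_norm (u + v) <= linf_norm u + linf_norm v.
Proof.
apply: linf_norm_le => n; apply: le_trans (ler_normD _ _) _.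
by rewrite lerD ?linf_norm_ge.
Qed.

Lemma linf_normZ_le (c : R[i]) u : linf_norm (c *: u) <= `|c| * linf_norm u.
Proof. by apply: linf_norm_le => n; rewrite normrM ler_wpM2l ?linf_norm_ge. Qed.

Lemma linf_normZ (c : R[i]) u : linf_norm (c *: u) = `|c| * linf_norm u.
Proof.
apply/le_anti; rewrite linf_normZ_le/=.
have [->|c0] := eqVneq c 0; first by rewrite normr0 mul0r linf_norm_ge0.
rewrite -ler_pdivlMl ?normr_gt0// -normfV.
by rewrite (le_trans _ (linf_normZ_le _ _))// scalerA mulVf// scale1r.
Qed.

Lemma linf_norm_eq0 u : linf_norm u = 0 -> u = 0.
Proof.
move=> u0; apply: linfE => n; apply/eqP.
by rewrite -normr_le0 -u0 linf_norm_ge.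
Qed.

HB.instance Definition _ := Lmodule_isNormed.Build R[i] linf
  linf_normD linf_normZ linf_norm_eq0.

Lemma bounded_seqM u v : (fun n => u n * v n) \in bounded_seq.
Proof.
apply/bounded_seqP; have [M uM] := linfP u; have [N vN] := linfP v.
by exists (M * N) => n; rewrite normrM ler_pM.
Qed.

Lemma bounded_seqJ u : (fun n => (u n)^*) \in bounded_seq.
Proof.
by apply/bounded_seqP; have [M uM] := linfP u; exists M => n; rewrite norm_conjC.
Qed.

Definition linf_mul u v : linf := Linf (bounded_seqM u v).

Definition linf_star u : linf := Linf (bounded_seqJ u).

Lemma linf_mulA : associative linf_mul.
Proof. by move=> u v w; apply: linfE => n; exact: mulrA. Qed.

Lemma linf_mulDl : left_distributive linf_mul +%R.
Proof. by move=> u v w; apply: linfE => n; exact: mulrDl. Qed.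

Lemma linf_mulDr : right_distributive linf_mul +%R.
Proof. by move=> u v w; apply: linfE => n; exact: mulrDr. Qed.

Lemma linf_mulZl (c : R[i]) u v : linf_mul (c *: u) v = c *: linf_mul u v.
Proof. by apply: linfE => n; exact: esym (mulrA _ _ _). Qed.

Lemma linf_mulZr (c : R[i]) u v : linf_mul u (c *: v) = c *: linf_mul u v.
Proof. by apply: linfE => n /=; exact: mulrCA. Qed.

Lemma linf_normM u v : `|linf_mul u v| <= `|u| * `|v|.
Proof.
by apply: linf_norm_le => n; rewrite normrM ler_pM// linf_norm_ge.
Qed.

HB.instance Definition _ := isNormedAlgebra.Build R linf
  linf_mulA linf_mulDl linf_mulDr linf_mulZl linf_mulZr linf_normM.

Lemma linf_starP : cstar_involution linf_star.
Proof.
split=> [u|u v|c u|u v|u].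
- by apply: linfE => n; exact: conjCK.
- by apply: linfE => n; exact: rmorphD.
- by apply: linfE => n; exact: rmorphM.
- by apply: linfE => n /=; rewrite rmorphM mulrC.
apply/le_anti/andP; split.
  apply: linf_norm_le => n; rewrite normrM norm_conjC -expr2.
  by rewrite lerXn2r ?nnegrE ?linf_norm_ge ?linf_norm_ge0.
have h n : `|u n| ^+ 2 <= `|linf_star u ** u|.
  rewrite expr2 -[X in X * _]norm_conjC -normrM.
  exact: linf_norm_ge (linf_star u ** u) n.
rewrite -[leRHS]sqrtCK lerXn2r ?nnegrE ?sqrtC_ge0//.
apply: linf_norm_le => n.
by rewrite -(@ler_pXn2r _ 2) ?nnegrE ?sqrtC_ge0// sqrtCK.
Qed.

End linf.

Definition linf_embeddable_uniform (R : realType) (A : normedAlgebraType R) :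
    Prop :=
  exists phi : A -> linf R,
    [/\ injective phi, alg_hom phi & forall a, `|phi a| = `|a|].

Definition linf_embeddable_cstar (R : realType) (A : normedAlgebraType R)
    (star : A -> A) : Prop :=
  exists phi : A -> linf R,
    [/\ injective phi, alg_hom phi
      & {morph phi : a / star a >-> @linf_star R a}].

(* Main.v *)
Require Import Defs.
From HB Require Import structures.
From mathcomp Require Import all_boot all_order all_algebra.
From mathcomp Require Import complex.
From mathcomp Require Import all_classical all_reals all_analysis.
From mathcomp Require Import ring lra.

(** Everything rests on one fact of Gelfand theory: in a commutative Banach
algebra with |x x| = |x|^2, each a <> 0 has a character phi with
|phi a| = |a| (uniform_norm_attained).  Given it, a sequence of characters
dense in Delta A yields the isometric homomorphism a |-> (phi_n a)_n, because
each condition |phi a| > r defines an open set of characters.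

The fact is proved without spectra, quotients or complex analysis.  Zorn's
lemma gives a minimal element p among the submultiplicative seminorms below
the norm that satisfy p(x)^2 <= p(x x) and p(a) >= |a|.  For p(b) > 0, the
infimum over n of p(x b^n) / p(b)^n is again such a seminorm, provided that
its value at a has not dropped; minimality then makes p(x b) = p(x) p(b).  The
proviso holds for b = a by power-multiplicativity, and then for every b since
p(a b^n) = p(a) p(b^n) (multiplicative_spectral_seminorm).  A nonzero
multiplicative seminorm on a complex algebra is the modulus of a character:
for each x some scalar la makes x - la null, by an elementary form of the
Gelfand-Mazur theorem in which the minimum m of p(x - la) is propagated to a
disc of fixed radius by factoring x^(2^k) - la^(2^k) (gelfand_mazur).

An abelian C*-algebra satisfies |x x| = |x|^2, and its characters commute with
the involution by Arens' argument: for self-adjoint h the C*-identity bounds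
|phi(h) + i t|^2 by |h|^2 + t^2 for all real t (functional_self_adjoint).  So
the isometric embedding is also a *-homomorphism.

For the converse, let phi be an injective *-homomorphism from A to the bounded
sequences.  The coordinates chi_n of phi are characters or zero, and the nonzero
ones are dense in Delta A.  If psi were not in their closure, a self-adjoint h would
exist with psi h = 1 and chi_n h <= 1 - eta for all n (peak_element).
Applying t |-> t ((t - c) + |t - c|) with c = 1 - eta to h produces an element
killed by all the chi_n but not by psi (cstar_positive_part), against
injectivity.  This single instance of the continuous functional calculus comes
from an explicit polynomial approximation of the absolute value. *)

Set Implicit Arguments.
Unset Strict Implicit.
Unset Printing Implicit Defensive.

Import Order.TTheory GRing.Theory Num.Theory.
Import numFieldNormedType.Exports.

Local Open Scope classical_set_scope.
Local Open Scope complex_scope.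
Local Open Scope ring_scope.

(** * Real-valued norms *)

Section RealNorm.
Variable R : realType.

(** Norms over R[i] take values in R[i], which is only partially ordered; the
real part carries all the information and makes infima available. *)
Definition nrm (V : normedZmodType R[i]) (x : V) : R := complex.Re `|x|.

Lemma nrmE (V : normedZmodType R[i]) (x : V) : `|x| = (nrm x)%:C.
Proof. by rewrite /nrm RRe_real// ger0_real. Qed.

Lemma nrm_ge0 (V : normedZmodType R[i]) (x : V) : 0 <= nrm x.
Proof. by rewrite -lecR -nrmE normr_ge0. Qed.

Lemma nrmD (V : normedZmodType R[i]) (x y : V) : nrm (x + y) <= nrm x + nrm y.
Proof. by rewrite -lecR rmorphD/= -!nrmE ler_normD. Qed.

Lemma nrm0 (V : normedZmodType R[i]) : nrm (0 : V) = 0.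
Proof. by rewrite /nrm normr0. Qed.

Lemma nrm_eq0 (V : normedZmodType R[i]) (x : V) : nrm x = 0 -> x = 0.
Proof. by move=> x0; apply/normr0_eq0; rewrite nrmE x0. Qed.

Lemma nrmN (V : normedZmodType R[i]) (x : V) : nrm (- x) = nrm x.
Proof. by rewrite /nrm normrN. Qed.

Lemma nrmM (c d : R[i]) : nrm (c * d) = nrm c * nrm d.
Proof. by apply: complexI; rewrite rmorphM/= -!nrmE normrM. Qed.

Lemma nrmX (c : R[i]) n : nrm (c ^+ n) = nrm c ^+ n.
Proof. by apply: complexI; rewrite rmorphXn/= -!nrmE normrX. Qed.

Lemma nrmZ (V : normedModType R[i]) (c : R[i]) (x : V) :
  nrm (c *: x) = nrm c * nrm x.
Proof. by apply: complexI; rewrite rmorphM/= -!nrmE normrZ. Qed.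

Lemma nrm1 : nrm (1 : R[i]) = 1.
Proof. by rewrite /nrm normr1. Qed.

Lemma nrmR (t : R) : nrm t%:C = `|t|.
Proof.
by apply: complexI; rewrite -nrmE normc_def/= expr0n/= addr0 sqrtr_sqr.
Qed.

Lemma nrmV (c : R[i]) : nrm c^-1 = (nrm c)^-1.
Proof. by apply: complexI; rewrite -nrmE normfV nrmE fmorphV. Qed.

Lemma nrm_sqr (z : R[i]) : nrm z ^+ 2 = complex.Re z ^+ 2 + complex.Im z ^+ 2.
Proof. by apply: complexI; rewrite add_Re2_Im2 nrmE rmorphXn. Qed.

Lemma nrm_amul (A : normedAlgebraType R) (x y : A) :
  nrm (x ** y) <= nrm x * nrm y.
Proof. by rewrite -lecR rmorphM/= -!nrmE norm_amul. Qed.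

End RealNorm.

(** * Seminorms and an elementary Gelfand-Mazur theorem *)

Section Seminorm.
Variables (R : realType) (V : lmodType R[i]).

Record seminorm (p : V -> R) : Prop := Seminorm {
  seminorm_ge0 : forall x, 0 <= p x;
  seminormD : forall x y, p (x + y) <= p x + p y;
  seminormZ_le : forall c x, p (c *: x) <= nrm c * p x }.

Variables (p : V -> R) (pS : seminorm p).

Lemma seminormZ c x : p (c *: x) = nrm c * p x.
Proof.
apply/le_anti; rewrite (seminormZ_le pS)/=.
have [->|c0] := eqVneq c 0; first by rewrite nrm0 mul0r (seminorm_ge0 pS).
have n0 : 0 < nrm c.
  by rewrite lt_neqAle nrm_ge0 andbT eq_sym;
    apply: contraNneq c0 => /nrm_eq0 ->.
rewrite -ler_pdivlMl// -nrmV; apply: le_trans (seminormZ_le pS _ _).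
by rewrite scalerA mulVf// scale1r.
Qed.

Lemma seminormN x : p (- x) = p x.
Proof. by rewrite -scaleN1r seminormZ nrmN nrm1 mul1r. Qed.

Lemma seminorm_dist x y : `|p x - p y| <= p (x - y).
Proof.
rewrite ler_norml; apply/andP; split; last first.
  by rewrite lerBlDr; apply: le_trans (seminormD pS _ _); rewrite subrK.
rewrite lerNl opprB lerBlDr -[p (x - y)]seminormN opprB.
by apply: le_trans (seminormD pS _ _); rewrite subrK.
Qed.

Variables (Z : {linear V -> V}) (m : R).
Hypothesis m0 : 0 <= m.
Hypothesis mZ : forall mu y, m * p y <= p (Z y - mu *: y).

Lemma iter_linear n : linear (iter n Z).
Proof. by move=> c x y; elim: n => //= n ->; rewrite linearP. Qed.

(** The operator identity Z^(2n) - nu^2 = (Z^n + nu) (Z^n - nu), at y. *)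
Lemma iter_dbl (nu : R[i]) n y : iter (n + n) Z y - nu ^+ 2 *: y =
  iter n Z (iter n Z y - nu *: y) - (- nu) *: (iter n Z y - nu *: y).
Proof.
have -> u v : iter n Z (u - nu *: v) = iter n Z u - nu *: iter n Z v.
  by rewrite -scaleNr addrC iter_linear scaleNr addrC.
rewrite iterD scaleNr opprK scalerBr scalerA -expr2.
by rewrite addrA subrK.
Qed.

(** Over the complex numbers Z^(2^k) - mu splits into 2^k factors Z - nu, each
of which expands p by at least m.  Exponents are powers of two so that square
roots suffice. *)
Lemma seminorm_iter_expn2_ge k mu y :
  m ^+ (2 ^ k) * p y <= p (iter (2 ^ k) Z y - mu *: y).
Proof.
elim: k mu y => [|k IH] mu y; first by rewrite expn0 expr1.
rewrite expnS mul2n -addnn exprD -[in X in _ <= X](sqrtCK mu) iter_dbl.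
apply: le_trans (IH _ _).
by rewrite -mulrA ler_wpM2l ?exprn_ge0.
Qed.

(** Same factorization, but keeping the factor Z - la aside: the remaining
2^k - 1 factors of Z^(2^k) - la^(2^k) each expand p by at least m. *)
Lemma seminorm_sub_expn2_ge k la y : m ^+ (2 ^ k) * p (Z y - la *: y) <=
  m * p (iter (2 ^ k) Z y - la ^+ (2 ^ k) *: y).
Proof.
elim: k => [|k IH]; first by rewrite expn0 expr1.
rewrite expnS mul2n -addnn exprD addnn -muln2 exprM muln2 -addnn iter_dbl.
apply: le_trans (ler_wpM2l m0 (seminorm_iter_expn2_ge k _ _)).
by rewrite -mulrA [leRHS]mulrCA ler_wpM2l ?exprn_ge0.
Qed.

End Seminorm.

(** ** Auxiliary real estimates *)

Section Minimum.
Variable R : realType.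

Lemma expr_small (s e : R) : 0 <= s < 1 -> 0 < e -> exists n, s ^+ n < e.
Proof.
move=> /andP[s0 s1] e0.
have : (fun n => s ^+ n) @ \oo --> (0 : R) by apply: cvg_expr;
  rewrite ger0_norm.
move=> /cvgrPdist_lt/(_ e e0)[n _ /(_ n (leqnn n))].
by rewrite /= sub0r normrN ger0_norm ?exprn_ge0//; exists n.
Qed.

Lemma expr_dominated (X Y c d : R) : 0 < c -> 0 <= X -> 0 <= Y -> 0 <= d ->
  (forall n, X ^+ n * c <= Y ^+ n * d) -> X <= Y.
Proof.
move=> c0 X0 Y0 d0 XY; rewrite leNgt; apply/negP => YX.
have {}X0 : 0 < X by exact: le_lt_trans YX.
have [||n sn] := @expr_small (Y / X) (c / (d + 1)).
- by rewrite divr_ge0 ?(ltW X0)//= ltr_pdivrMr// mul1r.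
- by rewrite divr_gt0//; lra.
have := XY n; apply/negP; rewrite -ltNge.
move: sn; rewrite expr_div_n ltr_pdivrMr ?exprn_gt0// mulrAC ltr_pdivlMr;
  last lra.
have : 0 <= Y ^+ n by rewrite exprn_ge0.
by rewrite (mulrC c); nra.
Qed.

Lemma nrm_Re (z : R[i]) : `|complex.Re z| <= nrm z.
Proof.
by rewrite -(@ler_pXn2r _ 2) ?nnegrE ?nrm_ge0//
  nrm_sqr -normrX ger0_norm ?sqr_ge0// lerDl sqr_ge0.
Qed.

Lemma nrm_Im (z : R[i]) : `|complex.Im z| <= nrm z.
Proof.
by rewrite -(@ler_pXn2r _ 2) ?nnegrE ?nrm_ge0//
  nrm_sqr -normrX ger0_norm ?sqr_ge0// lerDr sqr_ge0.
Qed.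

Lemma nrm_le_ReIm (z : R[i]) : nrm z <= `|complex.Re z| + `|complex.Im z|.
Proof.
rewrite -(@ler_pXn2r _ 2) ?nnegrE ?nrm_ge0 ?addr_ge0//.
rewrite nrm_sqr sqrrD -!normrX !(ger0_norm (sqr_ge0 _)) lerD2r lerDl.
by rewrite mulrn_wge0// mulr_ge0.
Qed.

(** A minimizer over the square of half-side g 0 + C is global: outside this
square the coercivity bound already exceeds g 0. *)
Lemma lipschitz_coercive_min (g : R[i] -> R) (C : R) :
  (forall x y, `|g x - g y| <= nrm (x - y)) -> (forall x, nrm x - C <= g x) ->
  exists x0, forall x, g x0 <= g x.
Proof.
move=> glip gC; pose K := g 0 + C.
have K0 : 0 <= K by have := gC 0; rewrite nrm0 /K; lra.
pose h (u : R * R) := g (u.1 +i* u.2).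
pose D : set (R * R) := `[- K, K]%classic `*` `[- K, K]%classic.
have D0 : D !=set0 by exists (0, 0); split; rewrite /= in_itv/= oppr_le0 K0.
have cD : compact D by apply: compact_setX; exact: segment_compact.
have hc : {within D, continuous h}.
  apply: continuous_subspaceT => u; apply/cvgrPdist_le => e e0; near=> v.
  apply: le_trans (glip _ _) _; apply: le_trans (nrm_le_ReIm _) _ => /=.
  rewrite (splitr e) lerD//; near: v.
    have := @cvg_fst _ _ (nbhs u.1) (nbhs u.2) _.
    move=> /(_ _)/cvgrPdist_le; apply; lra.
  have := @cvg_snd _ _ (nbhs u.1) (nbhs u.2) _.
  move=> /(_ _)/cvgrPdist_le; apply; lra.
have [[a b] abD hmin] := compact_EVT_min D0 cD hc.
exists (a +i* b) => x.
have [xK|Kx] := leP (nrm x) K.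
  have := hmin (complex.Re x, complex.Im x); rewrite /h/=;
    case: x xK => x y xK; apply.
  have /= := nrm_Re (x +i* y); have /= := nrm_Im (x +i* y).
  by rewrite inE; split; rewrite /= in_itv/= -ler_norml; lra.
have h0 : g (a +i* b) <= g 0.
  by apply: (hmin (0, 0)); rewrite inE; split; rewrite /= in_itv/= oppr_le0 K0.
by have := gC x; move: Kx h0; rewrite /K; lra.
Unshelve. all: by end_near. Qed.

End Minimum.

(** ** The Gelfand-Mazur argument *)

Section GelfandMazur.
Variables (R : realType) (V : lmodType R[i]) (p : V -> R) (pS : seminorm p).

(** If Z - mu expands p by at least m for every mu while Z multiplies p on the
orbit of e by exactly m, then for N = 2^k and |la| < m
m^(N-1) p((Z - la) e) <= p((Z^N - la^N) e) <= (m^N + |la|^N) p(e),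
and N -> oo gives the bound.  What matters is that the radius m / 2 depends
only on m. *)
Lemma seminorm_extremal_radius (Z : {linear V -> V}) (m : R) (e : V) :
  0 < m -> (forall mu y, m * p y <= p (Z y - mu *: y)) ->
  (forall n, p (iter n Z e) = m ^+ n * p e) ->
  forall la, nrm la <= m / 2 -> p (Z e - la *: e) <= m * p e.
Proof.
move=> m0 mZ Ze la lam.
have pe0 := seminorm_ge0 pS e.
have key k : p (Z e - la *: e) <= m * p e * (1 + 2^-1 ^+ (2 ^ k)).
  have mk0 : 0 < m ^+ (2 ^ k) by rewrite exprn_gt0.
  rewrite -(ler_pM2l mk0);
    apply: le_trans (seminorm_sub_expn2_ge (ltW m0) mZ _ _ _) _.
  have : p (iter (2 ^ k) Z e - la ^+ (2 ^ k) *: e) <=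
         m ^+ (2 ^ k) * p e + (m / 2) ^+ (2 ^ k) * p e.
    apply: le_trans (seminormD pS _ _) _;
      rewrite Ze seminormN// lerD2l seminormZ// nrmX.
    by rewrite ler_wpM2r// lerXn2r// ?nnegrE ?nrm_ge0//; lra.
  move=> /(ler_wpM2l (ltW m0)) /le_trans; apply.
  by rewrite exprMn le_eqVlt; apply/orP; left; apply/eqP; ring.
apply/ler_addgt0Pr => e0 e00.
have [n n_small] : exists n, (2^-1 : R) ^+ n < e0 / (m * p e + 1).
  have : 0 <= (2^-1 : R) < 1 by lra.
  by move=> /expr_small; apply; rewrite divr_gt0//; nra.
have [k nk] : exists k, (n <= 2 ^ k)%N by exists n; exact: ltnW (ltn_expl _ _).
apply: le_trans (key k) _; rewrite mulrDr mulr1 lerD2l.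
have : (2^-1 : R) ^+ (2 ^ k) <= 2^-1 ^+ n by apply: ler_wiXn2l => //; lra.
move: n_small; rewrite ltr_pdivlMr; last by nra.
set a := _ ^+ n; set b := _ ^+ (_ ^ _) => ae ba.
have a0 : 0 <= a by rewrite exprn_ge0//; lra.
have mp0 : 0 <= m * p e by nra.
by nra.
Qed.

(** The hypothesis on Z is what multiplication by an element satisfies when p
is multiplicative.  The function g la = p((Z - la) e) / p(e) has a minimum m.
If m > 0, the previous lemma spreads the value m from any minimizer to a disc
of radius m / 2, so g = m along an arithmetic progression going to infinity,
whereas g grows like |la|. *)
Lemma gelfand_mazur (Z : {linear V -> V}) (e : V) : 0 < p e ->
  (forall la y, p (Z y - la *: y) * p e = p (Z e - la *: e) * p y) ->
  exists la, p (Z e - la *: e) = 0.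
Proof.
move=> e0 Zmul; pose g la := p (Z e - la *: e) / p e.
have gE la y : p (Z y - la *: y) = g la * p y.
  by rewrite /g mulrAC -Zmul mulfK// gt_eqF.
have pV0 : 0 <= (p e)^-1 by rewrite invr_ge0 ltW.
have glip x y : `|g x - g y| <= nrm (x - y).
  rewrite /g -mulrBl normrM (ger0_norm pV0).
  rewrite ler_pdivrMr//; apply: le_trans (seminorm_dist pS _ _) _.
  by rewrite opprB addrC addrA subrK -scalerBl seminormZ// -nrmN opprB.
have gC x : nrm x - p (Z e) / p e <= g x.
  rewrite /g -(@ler_pM2r _ (p e))// mulrBl !mulfVK ?gt_eqF//.
  rewrite -seminormZ// lerBlDr -(seminormN pS (_ - _)).
  by apply: le_trans (seminormD pS _ _); rewrite opprB subrK.
have [la0 gmin] := lipschitz_coercive_min glip gC.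
have g_ge0 la : 0 <= g la by rewrite divr_ge0 ?(seminorm_ge0 pS).
have [m0|] := ltP 0 (g la0); last first.
  move=> g0; exists la0; apply/eqP; rewrite gE mulf_eq0 eq_le g0 g_ge0.
  by rewrite orTb.
set m := g la0 in m0 gmin.
have step la1 mu : g la1 = m -> nrm mu <= m / 2 -> g (la1 + mu) = m.
  move=> g1 mum; apply/eqP; rewrite eq_le gmin andbT.
  have Z1l : linear (fun y => Z y - la1 *: y).
    move=> c x y; rewrite linearP scalerBr scalerDr !scalerA (mulrC c) opprD.
    by rewrite addrACA.
  pose T := GRing.isLinear.Build _ _ _ _ _ Z1l.
  pose Z1 : {linear V -> V} := HB.pack (fun y => Z y - la1 *: y) T.
  have Z1E mu' y : Z1 y - mu' *: y = Z y - (la1 + mu') *: y.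
    by rewrite /= -addrA -opprD -scalerDl.
  rewrite -(ler_pM2r e0) -gE -Z1E; apply: seminorm_extremal_radius => //.
    by move=> mu' y; rewrite Z1E gE ler_wpM2r// (seminorm_ge0 pS).
  by elim=> [|n IH]; rewrite ?mul1r//= gE g1 IH exprS mulrA.
have gconst n : g (la0 + (m / 2 *+ n)%:C) = m.
  elim: n => [|n IH]; first by rewrite mulr0n addr0.
  rewrite mulrSr rmorphD/= addrA.
  by apply: step => //; rewrite nrmR ger0_norm//; lra.
(* The coercivity bound at la0 + n m / 2 fails once n m / 2 exceeds B. *)
pose B := m + p (Z e) / p e + nrm la0.
have [n nB] : exists n, B < m / 2 *+ n.
  exists (Num.truncn (B / (m / 2))).+1.
  rewrite -mulr_natl -ltr_pdivrMr; last lra.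
  exact: truncnS_gt.
have := gC (la0 + (m / 2 *+ n)%:C); rewrite gconst.
have := nrmD (- la0) (la0 + (m / 2 *+ n)%:C).
rewrite addKr nrmN nrmR ger0_norm; last by rewrite mulrn_wge0//; lra.
by move: nB; rewrite /B; lra.
Qed.

End GelfandMazur.

(** * Multiplicative seminorms from a power-multiplicative norm *)

Section AlgebraTheory.
Variables (R : realType) (A : normedAlgebraType R).
Implicit Types x y : A.

Lemma amulBl x y z : (x - y) ** z = x ** z - y ** z.
Proof. by rewrite amulDl -scaleN1r amulZl scaleN1r. Qed.

Lemma amulBr x y z : z ** (x - y) = z ** x - z ** y.
Proof. by rewrite amulDr -scaleN1r amulZr scaleN1r. Qed.

Lemma amul_linear x : linear (@amul R A x).
Proof. by move=> c y z; rewrite amulDr amulZr. Qed.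

HB.instance Definition _ x := GRing.isLinear.Build _ _ _ _ _ (amul_linear x).

Hypothesis abA : abelian_algebra A.

Lemma iter_amul_mul b n m x y : iter (n + m) (amul b) (x ** y) =
  iter n (amul b) x ** iter m (amul b) y.
Proof.
elim: n m => [|n IH] m; last by rewrite addSn /= IH amulA.
by elim: m => //= m ->; rewrite !amulA (abA b).
Qed.

End AlgebraTheory.

Section Infimum.
Variables (R : realType) (I : Type) (i0 : I).
Implicit Types f : I -> R.

Lemma inf_range_le f i : (forall j, 0 <= f j) -> inf (range f) <= f i.
Proof.
move=> f0; apply: ge_inf; last by exists i.
by exists 0 => _ [j _ <-].
Qed.

Lemma le_inf_range f t : (forall j, t <= f j) -> t <= inf (range f).
Proof.
by move=> tf; apply: lb_le_inf; [exists (f i0), i0 | move=> _ [j _ <-]].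
Qed.

(** For c = 0 both sides must be compared directly, dividing being impossible;
t <= 0 then comes from the index i0. *)
Lemma le_mul_inf_range f c t : 0 <= c -> (forall j, t <= c * f j) ->
  t <= c * inf (range f).
Proof.
rewrite le_eqVlt => /predU1P[<-|c0] tf; first by have := tf i0; rewrite !mul0r.
by rewrite -ler_pdivrMl//; apply: le_inf_range => j; rewrite ler_pdivrMl.
Qed.

End Infimum.

Section SpectralSeminorm.
Variables (R : realType) (A : normedAlgebraType R).
Hypothesis abA : abelian_algebra A.
Hypothesis normX : forall x : A, nrm (x ** x) = nrm x ^+ 2.
Variable a : A.

(** Seminorms that keep the value of the norm at a; with the bounds below they
satisfy p(x x) = p(x)^2 and p(a) = |a|.  All clauses are inequalities so that
they pass to infima. *)
Record spectral_seminorm (p : A -> R) : Prop := SpectralSeminorm {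
  spectral_is_seminorm : seminorm p;
  spectralM : forall x y, p (x ** y) <= p x * p y;
  spectralX : forall x, p x ^+ 2 <= p (x ** x);
  spectral_le : forall x, p x <= nrm x;
  spectral_ge : nrm a <= p a }.

(** The infimum of a family that is only asymptotically spectral: the indices
on the two sides of each inequality may differ.  This covers both chains,
where one takes the smaller of two members, and the decreasing sequences of
spectral_localization, whose members are not submultiplicative. *)
Lemma spectral_inf (I : Type) (i0 : I) (P : I -> A -> R) :
  (forall i x, 0 <= P i x) ->
  (forall i j x y, exists k, P k (x + y) <= P i x + P j y) ->
  (forall i c x, P i (c *: x) <= nrm c * P i x) ->
  (forall i j x y, exists k, P k (x ** y) <= P i x * P j y) ->
  (forall i x, exists j, P j x ^+ 2 <= P i (x ** x)) ->
  (forall x, P i0 x <= nrm x) ->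
  (forall i, nrm a <= P i a) ->
  exists q, spectral_seminorm q /\ forall i x, q x <= P i x.
Proof.
move=> P0 PD PZ PM PX Ple Pa; pose q x := inf (range (P^~ x)).
have qP i x : q x <= P i x by exact: inf_range_le.
have q0 x : 0 <= q x by exact: (le_inf_range i0).
exists q; split=> //; split; [split| | | |] => //.
- move=> x y; rewrite -lerBlDl; apply: (le_inf_range i0) => // j.
  rewrite lerBlDl -lerBlDr; apply: (le_inf_range i0) => // i.
  by rewrite lerBlDr; have [k] := PD i j x y; exact: le_trans.
- move=> c x; apply: (le_mul_inf_range i0) => //; first exact: nrm_ge0.
  by move=> j; exact: le_trans (PZ _ _ _).
- move=> x y; apply: (le_mul_inf_range i0) => // j; rewrite mulrC.
  apply: (le_mul_inf_range i0) => // i; rewrite mulrC.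
  by have [k] := PM i j x y; exact: le_trans.
- move=> x; apply: (le_inf_range i0) => // i; have [j] := PX i x.
  by apply: le_trans; rewrite lerXn2r ?nnegrE.
- by move=> x; exact: le_trans (Ple x).
- exact: (le_inf_range i0).
Qed.

Lemma nrm_spectral : spectral_seminorm (@nrm R A).
Proof.
split=> //; last by move=> x; rewrite normX.
  by split=> [x|x y|c x]; rewrite ?nrm_ge0 ?nrmD ?nrmZ.
exact: nrm_amul.
Qed.

Lemma minimal_spectral_seminorm : exists p, spectral_seminorm p /\
  forall q, spectral_seminorm q -> (forall x, q x <= p x) -> q = p.
Proof.
pose T := {p : A -> R | spectral_seminorm p}.
pose r (p q : T) := `[< forall x, sval q x <= sval p x >].
have [||[p pS] [q qS] /asboolP pq /asboolP qp|C Ctot|[p pS] pmin] := @Zorn T r.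
- by move=> p; exact/asboolP.
- move=> p q s /asboolP qp /asboolP sq; apply/asboolP => x.
  exact: le_trans (sq x) (qp x).
- by apply: eq_exist; apply/funext => x; apply/le_anti; rewrite (pq x) (qp x).
- have [[c0 Cc0]|C0] := pselect (exists c, C c); last first.
    exists (exist _ _ nrm_spectral) => s Cs; exfalso; apply: C0; by exists s.
  pose I := {c : T | C c}; pose P (i : I) := sval (sval i).
  have PS i : spectral_seminorm (P i) by exact: (svalP (sval i)).
  have Pmin (i j : I) :
      exists k : I, forall x, P k x <= P i x /\ P k x <= P j x.
    have [/asboolP ij|/asboolP ji] := Ctot _ _ (svalP i) (svalP j).
      by exists j => x; split=> //; exact: ij.
    by exists i => x; split=> //; exact: ji.
  have [|||||||q [qS qP]] := @spectral_inf I (exist _ c0 Cc0) P.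
  + by move=> i x; exact: seminorm_ge0 (spectral_is_seminorm (PS i)) _.
  + move=> i j x y; have [k kij] := Pmin i j; exists k.
    apply: le_trans (seminormD (spectral_is_seminorm (PS k)) _ _) _.
    by apply: lerD; [exact: (kij x).1|exact: (kij y).2].
  + by move=> i c x; exact: seminormZ_le (spectral_is_seminorm (PS i)) _ _.
  + move=> i j x y; have [k kij] := Pmin i j; exists k.
    apply: le_trans (spectralM (PS k) _ _) _.
    have k0 := seminorm_ge0 (spectral_is_seminorm (PS k)).
    by apply: ler_pM => //; [exact: (kij x).1|exact: (kij y).2].
  + by move=> i x; exists i; exact: spectralX (PS i) _.
  + by move=> x; exact: spectral_le (PS _) _.
  + by move=> i; exact: spectral_ge (PS i).
  exists (exist _ q qS) => s Cs; apply/asboolP => x /=.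
  exact: (qP (exist _ s Cs)).
exists p; split=> // q qS qp.
have /pmin[] : r (exist _ p pS) (exist _ q qS) by exact/asboolP.
by [].
Qed.

Section Localization.
Variables (p : A -> R) (pS : spectral_seminorm p).

Let p0 x : 0 <= p x.
Proof. exact: seminorm_ge0 (spectral_is_seminorm pS) x. Qed.

Lemma spectral_iter_le b n x : p (iter n (amul b) x) <= p b ^+ n * p x.
Proof.
elim: n => [|n IH]; first by rewrite mul1r.
by apply: le_trans (spectralM pS _ _) _; rewrite exprS -mulrA ler_wpM2l.
Qed.

(** Since iter n (amul b) b is b^(n+1), this says p(b^(n+1)) >= p(b)^(n+1).
Squaring gives it for arbitrarily large exponents m + 1, and
p(b^(m+1)) <= p(b)^(m-n) p(b^(n+1)) brings it down to all of them. *)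
Lemma spectral_iter_ge b n : p b ^+ n.+1 <= p (iter n (amul b) b).
Proof.
have [->|b0] := eqVneq (p b) 0; first by rewrite expr0n.
have {}b0 : 0 < p b by rewrite lt_def b0 p0.
have [m nm hm] : exists2 m, (n <= m)%N & p b ^+ m.+1 <= p (iter m (amul b) b).
  elim: n => [|n [m nm hm]]; first by exists 0%N; rewrite ?expr1.
  exists (m + m).+1; first by rewrite ltnS (leq_trans nm)// leq_addr.
  rewrite iterSr iter_amul_mul//; apply: le_trans (spectralX pS _).
  have -> : (m + m).+2 = (m.+1 * 2)%N by rewrite muln2 -addnn addnS.
  by rewrite exprM lerXn2r// nnegrE ?exprn_ge0.
rewrite -(ler_pM2l (exprn_gt0 (m - n) b0)) -exprD addnS subnK//.
by rewrite (le_trans hm)// -{1}(subnK nm) iterD spectral_iter_le.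
Qed.

(** The infimum over n of p(x b^n) / p(b)^n.  These quotients decrease in n, and
the indices of two of them add up in a product, which is the form required by
spectral_inf.  The term n = 1 bounds q(x) p(b) by p(b x), and the hypothesis
keeps the value at a from decreasing. *)
Lemma spectral_localization b : 0 < p b ->
  (forall n, nrm a * p b ^+ n <= p (iter n (amul b) a)) ->
  exists q, [/\ spectral_seminorm q, forall x, q x <= p x
    & forall x, q x * p b <= p (b ** x)].
Proof.
move=> b0 ab; pose P n x := p (iter n (amul b) x) / p b ^+ n.
have bn n : 0 < p b ^+ n by rewrite exprn_gt0.
have Panti n k x : P (n + k)%N x <= P n x.
  rewrite /P ler_pdivrMr//.
  have -> : p (iter n (amul b) x) / p b ^+ n * p b ^+ (n + k) =
      p b ^+ k * p (iter n (amul b) x).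
    by rewrite exprD mulrA mulfVK ?gt_eqF// mulrC.
  by rewrite addnC iterD spectral_iter_le.
have PS n : seminorm (P n).
  have pSS := spectral_is_seminorm pS; have bn0 : 0 <= (p b ^+ n)^-1.
    by rewrite invr_ge0 ltW.
  have iterL := @iter_linear R A (@amul R A b) n.
  split=> [x|x y|c x]; rewrite /P.
  - by rewrite mulr_ge0.
  - rewrite -mulrDl ler_wpM2r//; have := iterL 1 x y.
    by rewrite !scale1r => ->; exact: seminormD.
  - rewrite mulrA ler_wpM2r//; have := iterL c x 0.
    have -> : iter n (amul b) 0 = 0.
      by have := iterL (-1) 0 0; rewrite !scaleN1r !oppr0 addr0 addNr.
    by rewrite !addr0 => ->; exact: seminormZ_le.
have [||||||| q [qS qP]] := @spectral_inf nat 0%N P.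
- by move=> n x; exact: seminorm_ge0.
- move=> i j x y; exists (i + j)%N; apply: le_trans (seminormD (PS _) _ _) _.
  by apply: lerD; [|rewrite addnC]; exact: Panti.
- by move=> n c x; exact: seminormZ_le.
- move=> i j x y; exists (i + j)%N.
  rewrite /P iter_amul_mul// exprD invfM mulrACA.
  rewrite ler_wpM2r ?mulr_ge0 ?invr_ge0 ?exprn_ge0//.
  exact: spectralM.
- move=> n x; exists n; apply: le_trans (Panti n n (x ** x)).
  rewrite /P iter_amul_mul// expr_div_n exprD -expr2.
  by rewrite ler_wpM2r ?invr_ge0 ?exprn_ge0// spectralX.
- by move=> x; rewrite /P divr1; exact: spectral_le.
- by move=> n; rewrite /P ler_pdivlMr.
exists q; split=> // x.
  by apply: le_trans (qP 0%N x) _; rewrite /P divr1.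
by rewrite -ler_pdivlMr//; apply: le_trans (qP 1%N x) _; rewrite /P expr1.
Qed.

End Localization.

(** By minimality p is its own localization at b, so p(x) p(b) <= p(b x).  The
case b = a comes first, because it is what verifies the hypothesis of
spectral_localization for the other b. *)
Lemma multiplicative_spectral_seminorm : 0 < nrm a ->
  exists2 p, spectral_seminorm p & forall x y, p (x ** y) = p x * p y.
Proof.
move=> a0; have [p [pS pmin]] := minimal_spectral_seminorm.
have p0 x : 0 <= p x by exact: seminorm_ge0 (spectral_is_seminorm pS) x.
have mulb b : 0 < p b ->
    (forall n, nrm a * p b ^+ n <= p (iter n (amul b) a)) ->
    forall x, p x * p b <= p (b ** x).
  move=> b0 ab; have [q [qS qp qb]] := spectral_localization pS b0 ab.
  by move: qb; rewrite (pmin q qS qp).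
have pa : p a = nrm a.
  by apply/le_anti; rewrite (spectral_le pS) (spectral_ge pS).
have mula : forall x, p x * p a <= p (a ** x).
  apply: mulb; first by rewrite pa.
  by move=> n; rewrite -pa -exprS spectral_iter_ge.
exists p => // x y; apply/le_anti; rewrite (spectralM pS)/=.
have [->|y0] := eqVneq (p y) 0; first by rewrite mulr0.
rewrite abA; apply: mulb; first by rewrite lt_def y0 p0.
case=> [|n]; first by rewrite mulr1 (spectral_ge pS).
have -> : iter n.+1 (amul y) a = a ** iter n (amul y) y.
  by elim: n => [|n /= ->]; rewrite /= ?(abA y)// !amulA (abA a).
by rewrite -pa mulrC; apply: le_trans (mula _);
  rewrite ler_wpM2r// spectral_iter_ge.
Qed.

End SpectralSeminorm.

(** * Characters of commutative Banach algebras *)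

Section Characters.
Variables (R : realType) (A : banachAlgebraType R).
Hypothesis abA : abelian_algebra A.

(** The scalar phi x makes x - phi x a p-null element of the unitization,
expressed in A by multiplying with e.  It is unique because p(e) > 0, and
uniqueness makes phi linear and multiplicative. *)
Lemma character_of_seminorm (p : A -> R) (e : A) : seminorm p -> 0 < p e ->
  (forall x y, p (x ** y) = p x * p y) ->
  exists2 phi, Delta A phi & forall x, nrm (phi x) = p x.
Proof.
move=> pS e0 pM.
have /choice[phi phiP] x : exists la, p (x ** e - la *: e) = 0.
  apply: (@gelfand_mazur _ _ _ pS (amul x)) => // la y.
  by rewrite -!pM !amulBl !amulZl -!amulA (abA y).
have phi_uniq x la : p (x ** e - la *: e) = 0 -> phi x = la.
  move=> h; have : p ((phi x - la) *: e) <= 0.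
    have -> : (phi x - la) *: e = (x ** e - la *: e) - (x ** e - phi x *: e).
      by rewrite opprB [in RHS]addrC -addrA (addrA (- _)) addNr add0r scalerBl.
    by apply: le_trans (seminormD pS _ _) _; rewrite seminormN// h phiP addr0.
  rewrite seminormZ// pmulr_lle0// => h0; apply/subr0_eq/nrm_eq0/le_anti.
  by rewrite h0 nrm_ge0.
have phiE x : nrm (phi x) = p x.
  apply: (mulIf (lt0r_neq0 e0)); rewrite -seminormZ// -pM.
  apply/eqP; rewrite -subr_eq0 -normr_le0.
  by apply: le_trans (seminorm_dist pS _ _) _; rewrite -seminormN// opprB phiP.
exists phi => //; split.
- move=> c x y; apply: phi_uniq.
  have -> : (c *: x + y) ** e - (c * phi x + phi y) *: e =
      c *: (x ** e - phi x *: e) + (y ** e - phi y *: e).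
    by rewrite amulDl amulZl scalerBr scalerDl scalerA opprD addrACA.
  apply/le_anti; rewrite (seminorm_ge0 pS) andbT.
  by apply: le_trans (seminormD pS _ _) _;
    rewrite seminormZ// !phiP mulr0 addr0.
- move=> x y; apply: phi_uniq.
  have -> : x ** y ** e - (phi x * phi y) *: e =
      x ** (y ** e - phi y *: e) + phi y *: (x ** e - phi x *: e).
    by rewrite amulBr amulZr scalerBr scalerA amulA (mulrC (phi x)) addrA subrK.
  apply/le_anti; rewrite (seminorm_ge0 pS) andbT.
  apply: le_trans (seminormD pS _ _) _.
  by rewrite seminormZ// pM !phiP !mulr0 addr0.
- by exists e; apply: contraTneq e0 => h; rewrite -phiE h nrm0 ltxx.
Qed.

Lemma uniform_norm_attained (a : A) : uniform_algebra A -> a != 0 ->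
  exists2 phi, Delta A phi & nrm (phi a) = nrm a.
Proof.
move=> [_ uA] a0.
have normX (x : A) : nrm (x ** x) = nrm x ^+ 2.
  by apply: complexI; rewrite rmorphXn/= -!nrmE.
have a0' : 0 < nrm a.
  by rewrite lt_def nrm_ge0 andbT; apply: contraNneq a0 => /nrm_eq0 ->.
have [p pS pM] := multiplicative_spectral_seminorm abA normX a0'.
have pa : p a = nrm a.
  by apply/le_anti; rewrite (spectral_le pS) (spectral_ge pS).
have [||phi phiD phiE] := @character_of_seminorm p a _ _ pM.
- exact: spectral_is_seminorm pS.
- by rewrite pa.
by exists phi; rewrite // phiE.
Qed.

End Characters.

(** ** Automatic continuity of characters *)

Section Limits.
Variables (R : realType) (V : completeNormedModType R[i]).

(** Completeness with an explicit rate, so that the limit inherits the error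
bounds of the sequence. *)
Lemma nrm_cauchy_limit (u : nat -> V) (c : nat -> R) :
  (forall n k, nrm (u (n + k)%N - u n) <= c n) ->
  (forall e, 0 < e -> exists n, c n < e) ->
  exists l, forall n, nrm (l - u n) <= c n.
Proof.
move=> uc c_small.
have : cvg (u @ \oo).
  apply/cauchy_cvgP/cauchy_exP => e e0.
  have eE : e = (complex.Re e)%:C by rewrite RRe_real// gtr0_real.
  have [|n cn] := c_small (complex.Re e); first by rewrite -ltcR -eE.
  exists (u n); exists n => // m /= nm.
  rewrite -ball_normE/= nrmE eE ltcR -nrmN opprB.
  by apply: le_lt_trans cn; have := uc n (m - n)%N; rewrite subnKC.
move=> /cvg_ex[l ul]; exists l => n.
apply/ler_addgt0Pr => e e0.
have e0C : 0 < e%:C by rewrite ltcR.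
have /cvgrPdist_le/(_ _ e0C)[N _ uN] := ul.
have := uN (n + N)%N (leq_addl _ _); rewrite /= nrmE lecR => lN.
rewrite -(subrK (u (n + N)%N) l) -addrA.
by apply: le_trans (nrmD _ _) _; rewrite [leRHS]addrC lerD.
Qed.

End Limits.

Section Contractive.
Variables (R : realType) (A : banachAlgebraType R).

(** Zero is included, since a coordinate of an embedding may vanish. *)
Definition multiplicative_functional (phi : A -> R[i]) : Prop :=
  scalar phi /\ {morph phi : a b / a ** b >-> a * b}.

Implicit Types (x y h : A) (chi phi : A -> R[i]).

Lemma functionalD chi (x y : A) : multiplicative_functional chi ->
  chi (x + y) = chi x + chi y.
Proof. by move=> [lin _]; have := lin 1 x y; rewrite scale1r mul1r. Qed.

Lemma functional0 chi : multiplicative_functional chi -> chi 0 = 0.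
Proof.
by move=> chiM; apply: (addrI (chi 0)); rewrite -functionalD// !addr0.
Qed.

Lemma functionalZ chi c (x : A) : multiplicative_functional chi ->
  chi (c *: x) = c * chi x.
Proof.
move=> chiM; have [lin _] := chiM.
by rewrite -[c *: x]addr0 lin functional0// addr0.
Qed.

Lemma functionalB chi (x y : A) : multiplicative_functional chi ->
  chi (x - y) = chi x - chi y.
Proof.
by move=> chiM; rewrite functionalD// -scaleN1r functionalZ// mulN1r.
Qed.

Lemma functional_sum chi (I : Type) (r : seq I) (F : I -> A) :
  multiplicative_functional chi ->
  chi (\sum_(i <- r) F i) = \sum_(i <- r) chi (F i).
Proof.
move=> chiM; elim: r => [|i r IH]; first by rewrite !big_nil functional0.
by rewrite !big_cons functionalD// IH.
Qed.

Lemma functional_iter chi (h : A) n x : multiplicative_functional chi ->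
  chi (iter n (amul h) x) = chi h ^+ n * chi x.
Proof.
move=> chiM; elim: n => [|n IH]; first by rewrite mul1r.
by rewrite /= chiM.2 IH exprS mulrA.
Qed.

(** l is the geometric series b + b^2 + ..., obtained by iterating the
contraction x |-> b + b x from 0. *)
Lemma quasi_inverse (b : A) : nrm b < 1 -> exists l, l = b + b ** l.
Proof.
set r := nrm b => r1; have r0 : 0 <= r by exact: nrm_ge0.
pose T x := b + b ** x; pose u n := iter n T 0.
have TB n x y : nrm (iter n T x - iter n T y) <= r ^+ n * nrm (x - y).
  elim: n => [|n IH]; first by rewrite mul1r.
  rewrite /= /T opprD addrACA subrr add0r -amulBr.
  by apply: le_trans (nrm_amul _ _) _; rewrite exprS -mulrA ler_wpM2l.
have u_le k : nrm (u k) <= (1 - r)^-1.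
  have V0 : 0 < (1 - r)^-1 by rewrite invr_gt0; lra.
  elim: k => [|k IH]; first by rewrite nrm0 ltW.
  apply: le_trans (nrmD _ _) _.
  have -> : (1 - r)^-1 = 1 + r * (1 - r)^-1 by field; lra.
  rewrite lerD ?(ltW r1)//; apply: le_trans (nrm_amul _ _) _.
  by rewrite ler_wpM2l.
pose c n := r ^+ n * (1 - r)^-1.
have c_small e : 0 < e -> exists n, c n < e.
  move=> e0; have [||n rn] := @expr_small R r (e * (1 - r)).
  - by rewrite r0.
  - by rewrite mulr_gt0//; lra.
  - by exists n; rewrite /c ltr_pdivrMr//; lra.
have [|l lu] := @nrm_cauchy_limit _ A u c _ c_small.
  move=> n k; rewrite /u iterD; apply: le_trans (TB _ _ _) _.
  by rewrite subr0 ler_wpM2l ?exprn_ge0// u_le.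
exists l; apply/subr0_eq/nrm_eq0/le_anti; rewrite nrm_ge0 andbT.
apply/ler_addgt0Pr => e e0; rewrite add0r.
have [n cn] := c_small (e / 2) ltac:(lra).
have -> : l - (b + b ** l) = (l - u n.+1) + (T (u n) - T l).
  by rewrite addrA subrK.
apply: le_trans (nrmD _ _) _; rewrite (splitr e); apply: lerD.
  apply: le_trans (lu _) _; apply: le_trans (ltW cn).
  rewrite /c exprS -mulrA ler_piMl ?(ltW r1)// mulr_ge0 ?exprn_ge0// invr_ge0;
    lra.
have := TB 1%N (u n) l; rewrite /= expr1 => /le_trans; apply.
apply: le_trans (ltW cn); rewrite -nrmN opprB; apply: le_trans (lu n).
by rewrite ler_piMl ?nrm_ge0// ltW.
Qed.

(** If |phi a| > |a|, then b = a / phi a has norm < 1 and phi b = 1; applying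
phi to l = b + b l gives phi l = 1 + phi l. *)
Lemma functional_contractive phi : multiplicative_functional phi ->
  forall a, nrm (phi a) <= nrm a.
Proof.
move=> phiM a; rewrite leNgt; apply/negP => lt_a.
have p0 : phi a != 0.
  by apply: contraTneq lt_a => ->; rewrite nrm0 -leNgt nrm_ge0.
pose b := (phi a)^-1 *: a.
have b1 : nrm b < 1.
  by rewrite nrmZ nrmV mulrC ltr_pdivrMr ?mul1r// (le_lt_trans _ lt_a)//
    nrm_ge0.
have [l lE] := quasi_inverse b1.
have : phi l = 1 + phi l.
  by rewrite {1}lE functionalD// phiM.2 functionalZ// mulVf// mul1r.
by move/eqP; rewrite -subr_eq subrr eq_sym oner_eq0.
Qed.

End Contractive.

(** * Embedding along a dense sequence of characters *)

Section Embedding.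
Variables (R : realType) (A : banachAlgebraType R).

Lemma eval_linf (g : nat -> A -> R[i]) :
  (forall n, multiplicative_functional (g n)) ->
  {phi : A -> linf R | alg_hom phi /\ forall a n, phi a n = g n a}.
Proof.
move=> gM; have gb a : (fun n => g n a) \in @bounded_seq R.
  apply/bounded_seqP; exists `|a| => n; rewrite !nrmE lecR.
  exact: functional_contractive.
exists (fun a => Linf (gb a)); split=> //; split.
  by move=> c x y; apply: linfE => n; exact: (gM n).1.
by move=> x y; apply: linfE => n; exact: (gM n).2.
Qed.

Lemma Delta_functional phi : Delta A phi -> multiplicative_functional phi.
Proof. by case. Qed.

Lemma zero_functional : multiplicative_functional (fun _ : A => 0).
Proof. by split=> [c x y|x y]; rewrite ?mulr0 ?addr0. Qed.

Lemma eval_Delta_continuous (a : A) :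
  continuous (fun phi : set_type (Delta A) => (set_val phi : A -> R[i]) a).
Proof.
move=> phi.
apply: (@continuous_comp _ {ptws A -> R[i]} _ set_val (fun f => f a)).
  exact: initial_continuous.
exact: (@proj_continuous A (fun _ => R[i])).
Qed.

(** Density enters through the open sets |phi a| > r.  Surplus indices carry the
zero functional, so that finite and empty dense sets need no special care. *)
Lemma separable_Delta_seq : separable_Delta A ->
  exists g : nat -> A -> R[i],
    (forall n, Delta A (g n) \/ g n = fun=> 0) /\
    forall phi a r, Delta A phi -> r < nrm (phi a) -> exists n, r < nrm (g n a).
Proof.
move=> [S [/countable_injP[f finj] Sdense]].
pose g n : A -> R[i] := match pselect (exists2 s, S s & f s = n) with
  | left h => set_val (sval (cid2 h)) | right _ => fun=> 0 end.
exists g; split=> [n|phi a r Dphi rphi].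
  rewrite /g; case: pselect => [h|_]; last by right.
  by left; case: cid2 => s /= _ _; exact: set_valP.
have [||s [/= rs Ss]] := Sdense [set s | r < nrm ((set_val s : A -> R[i]) a)].
- by exists (SigSub (mem_set Dphi)).
- pose ev (s : set_type (Delta A)) := (set_val s : A -> R[i]) a.
  apply: (@open_comp _ _ ev [set z | r < nrm z]) => [s _|].
    exact: eval_Delta_continuous.
  rewrite openE => z /= rz; rewrite /interior -nbhs_ballE.
  exists (nrm z - r)%:C; first by rewrite /= ltcR; lra.
  move=> w; rewrite -ball_normE/= nrmE ltcR => zw.
  by have := nrmD w (z - w); rewrite addrC subrK; lra.
exists (f s); rewrite /g.
case: pselect => [h|[]]; last by exists s.
case: cid2 => s' Ss' fs' /=.
by rewrite (finj s' s) ?inE.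
Qed.

Lemma separable_isometric_eval : uniform_algebra A -> separable_Delta A ->
  exists phi : A -> linf R,
    [/\ injective phi, alg_hom phi, forall a, `|phi a| = `|a|
      & forall n, multiplicative_functional (fun a => phi a n)].
Proof.
move=> uA /separable_Delta_seq[g [gD g_dense]].
have gM n : multiplicative_functional (g n).
  by have [/Delta_functional//|->] := gD n; exact: zero_functional.
have [phi [phiH phiE]] := eval_linf gM.
have phiN a : `|phi a| = `|a|.
  apply/le_anti/andP; split.
    apply: linf_norm_le => n; rewrite phiE !nrmE lecR.
    exact: functional_contractive.
  have [->|a0] := eqVneq a 0; first by rewrite normr0.
  have [chi chiD chia] := uniform_norm_attained (proj1 uA) uA a0.
  rewrite !nrmE lecR leNgt; apply/negP;
    rewrite -chia => /(g_dense _ _ _ chiD)[n].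
  apply/negP; rewrite -leNgt -lecR -!nrmE -phiE; exact: linf_norm_ge.
exists phi; split=> // [x y xy|n].
  apply/subr0_eq/normr0_eq0; rewrite -phiN -scaleN1r addrC.
  by rewrite (proj1 phiH) xy scaleN1r addNr normr0.
have -> : (fun a => phi a n) = g n by apply/funext => a; exact: phiE.
exact: gM.
Qed.

End Embedding.

(** * Polynomial approximation of the absolute value *)

Section AbsApprox.
Variable R : realType.

(** The classical iteration q + (s^2 - q^2) / 2, whose fixed points are
q = |s| and q = - |s|; started at 0 it increases to |s| when |s| <= 1. *)
Fixpoint abs_poly (n : nat) : {poly R} :=
  if n is n'.+1 then
    abs_poly n' + 2^-1 *: ('X ^+ 2 - abs_poly n' ^+ 2)
  else 0.

Lemma abs_polyS n (s : R) :
  (abs_poly n.+1).[s] = (abs_poly n).[s] + (s ^+ 2 - (abs_poly n).[s] ^+ 2) / 2.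
Proof. by rewrite /= !hornerE mulrC. Qed.

(** One step multiplies the error |s| - q by 1 - (|s| + q) / 2, which lies
between 0 and 1 - |s| / 2. *)
Lemma abs_poly_bound n (s : R) : `|s| <= 1 ->
  0 <= (abs_poly n).[s] <= `|s| /\
  `|s| - (abs_poly n).[s] <= `|s| * (1 - `|s| / 2) ^+ n.
Proof.
move=> s1; have s0 := normr_ge0 s.
have s2 : s ^+ 2 = `|s| ^+ 2 by rewrite -normrX ger0_norm ?sqr_ge0.
elim: n => [|n [/andP[q0 qs] qn]];
  first by rewrite /= horner0 lexx s0 mulr1 subr0.
rewrite abs_polyS s2; move: q0 qs qn.
set q := _.[s]; set r := `|s| in s0 s1 *; set w := _ ^+ n => q0 qs qn.
split; first by apply/andP; split; nra.
rewrite [_ ^+ n.+1]exprS -/w.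
have -> : r - (q + (r ^+ 2 - q ^+ 2) / 2) = (r - q) * (1 - (r + q) / 2).
  by field.
have : (r - q) * (1 - (r + q) / 2) <= (r - q) * (1 - r / 2) by nra.
have : (r - q) * (1 - r / 2) <= r * w * (1 - r / 2) by nra.
by lra.
Qed.

(** From (1 - x)^n (1 + n x) <= 1, itself by induction, and
(n + 1) x <= 1 + n x. *)
Lemma bernoulli_decay (x : R) n : 0 <= x <= 1 ->
  x * (1 - x) ^+ n <= n.+1%:R^-1.
Proof.
move=> /andP[x0 x1].
have B : (1 - x) ^+ n * (1 + n%:R * x) <= 1.
  elim: n => [|n IH]; first by rewrite mul1r mul0r addr0.
  apply: le_trans IH; rewrite exprSr -mulrA ler_wpM2l ?exprn_ge0//; first lra.
  by rewrite -natr1; have : 0 <= n%:R :> R by []; nra.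
rewrite -[leRHS]mul1r ler_pdivlMr ?ltr0Sn//; apply: le_trans B.
rewrite mulrAC mulrC ler_wpM2l ?exprn_ge0//; first lra.
by rewrite -natr1; have : 0 <= n%:R :> R by []; nra.
Qed.

Lemma abs_poly_approx (L : R) : 0 < L -> exists q : nat -> {poly R},
  forall n t, `|t| <= L -> `|(q n).[t] - `|t| | <= 2 * L / n.+1%:R.
Proof.
move=> L0; exists (fun n => L *: (abs_poly n \Po (L^-1 *: 'X))) => n t tL.
rewrite !hornerE horner_comp !hornerE mulrC.
set s := L^-1 * t.
have tE : `|t| = L * `|s|.
  by rewrite /s normrM normfV (gtr0_norm L0) mulrA mulfV ?mul1r// gt_eqF.
have s1 : `|s| <= 1 by rewrite -(ler_pM2l L0) -tE mulr1.
have [/andP[q0 qs] qn] := abs_poly_bound n s1.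
rewrite tE (mulrC _ L) -mulrBr normrM (gtr0_norm L0) (mulrC 2)
  -mulrA ler_pM2l//.
rewrite distrC ger0_norm ?subr_ge0//; apply: le_trans qn _.
have s20 : 0 <= `|s| / 2 <= 1 by have := normr_ge0 s; lra.
have := bernoulli_decay n s20; set w := _ ^+ n => h.
have -> : `|s| * w = 2 * (`|s| / 2 * w) by field.
by rewrite ler_wpM2l.
Qed.

End AbsApprox.

(** * Characters of abelian C*-algebras *)

Section Cstar.
Variables (R : realType) (A : banachAlgebraType R) (star : A -> A).
Hypotheses (abA : abelian_algebra A) (sA : cstar_involution star).
Implicit Types (h x y : A) (chi : A -> R[i]).

(** |a a|^2 = |(a a)^* (a a)| = |(a^* a)^* (a^* a)| = |a|^4, the middle step by
commutativity. *)
Lemma cstar_uniform : uniform_algebra A.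
Proof.
split=> // a; apply/eqP.
rewrite -(@eqrXn2 _ 2)// ?exprn_ge0//.
rewrite -(norm_starM sA) (starM sA).
have -> : star a ** star a ** (a ** a) = star (star a ** a) ** (star a ** a).
  rewrite (starM sA) (starK sA) -!amulA; congr (_ ** _).
  by rewrite amulA; exact: abA.
by rewrite !(norm_starM sA).
Qed.

Lemma nrm_star_amul x : nrm (star x ** x) = nrm x ^+ 2.
Proof. by apply: complexI; rewrite rmorphXn/= -!nrmE (norm_starM sA). Qed.

Lemma starZR (t : R) x : star (t%:C *: x) = t%:C *: star x.
Proof. by rewrite (starZ sA) /Num.conj/= oppr0. Qed.

Lemma starN x : star (- x) = - star x.
Proof. by rewrite -scaleN1r (starZ sA) rmorphN1 scaleN1r. Qed.

(** Arens' argument without a unit.  The operator T x = h x + i t x satisfies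
|T x|^2 <= (|h|^2 + t^2) |x|^2, since (T x)^* (T x) = (h^2 + t^2) x^* x.
Iterating T from h and letting chi act, n-th roots yield
|chi h + i t|^2 <= |h|^2 + t^2 for every real t.  The terms t^2 cancel, and
the remaining linear function of t is bounded only if Im (chi h) = 0. *)
Lemma functional_self_adjoint chi h : multiplicative_functional chi ->
  star h = h -> complex.Im (chi h) = 0.
Proof.
move=> chiM hs; have [->//|ch0] := eqVneq (chi h) 0.
pose N := nrm h.
have c0 : 0 < nrm (chi h) ^+ 2.
  by rewrite exprn_gt0// lt_def nrm_ge0 andbT;
    apply: contra_neq ch0 => /nrm_eq0.
have key (t : R) : nrm (chi h + t *i) ^+ 2 <= N ^+ 2 + t ^+ 2.
  pose T x := h ** x + t *i *: x.
  have conjt : (t *i : R[i])^* = - (t *i).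
    by apply/eqP; rewrite eq_complex /= oppr0 !eqxx.
  have T_le x : nrm (T x) ^+ 2 <= (N ^+ 2 + t ^+ 2) * nrm x ^+ 2.
    rewrite -(nrm_star_amul (T x)).
    have -> : star (T x) ** T x =
        h ** (h ** (star x ** x)) + (t ^+ 2)%:C *: (star x ** x).
      rewrite /T (starD sA) (starM sA) (starZ sA) hs conjt scaleNr.
      rewrite amulBl !amulDr !amulZl !amulZr scalerA.
      have -> : star x ** h ** (h ** x) = h ** (h ** (star x ** x)).
        by rewrite (abA _ h) -!amulA; congr (_ ** _); rewrite !amulA (abA _ h).
      have -> : star x ** h ** x = h ** (star x ** x).
        by rewrite (abA _ h) amulA.
      have -> : star x ** (h ** x) = h ** (star x ** x).
        by rewrite amulA (abA _ h) -amulA.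
      rewrite opprD addrA addrK -scaleNr; congr (_ + _ *: _).
      by apply/eqP; rewrite eq_complex /=; apply/andP; split; apply/eqP; ring.
    apply: le_trans (nrmD _ _) _; rewrite mulrDl lerD//.
      apply: le_trans (nrm_amul _ _) _;
        rewrite expr2 -mulrA ler_wpM2l ?nrm_ge0//.
      by apply: le_trans (nrm_amul _ _) _; rewrite nrm_star_amul.
    by rewrite nrmZ nrmR nrm_star_amul ger0_norm ?sqr_ge0.
  apply: (@expr_dominated _ _ _ _ (N ^+ 2) c0);
    rewrite ?addr_ge0 ?sqr_ge0// => n.
  have E : chi (iter n T h) = (chi h + t *i) ^+ n * chi h.
    elim: n => [|n IH]; first by rewrite mul1r.
    by rewrite /= functionalD// chiM.2 functionalZ// IH exprS; ring.
  rewrite -exprM mulnC exprM -nrmX -exprMn -nrmM -E.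
  have le_n : nrm (iter n T h) ^+ 2 <= (N ^+ 2 + t ^+ 2) ^+ n * N ^+ 2.
    elim: n {E} => [|n IH]; first by rewrite mul1r.
    rewrite [_ ^+ n.+1]exprS -mulrA; apply: le_trans (T_le _) _.
    by rewrite ler_wpM2l// addr_ge0 ?sqr_ge0.
  apply: le_trans le_n; rewrite lerXn2r ?nnegrE ?nrm_ge0//.
  exact: functional_contractive.
set b := complex.Im (chi h); apply/eqP; apply/negPn/negP => b0.
(* For this t the cross term 2 b t equals N^2 + 1, which exceeds N^2. *)
have := key ((N ^+ 2 + 1) / (2 * b)); rewrite nrm_sqr.
set s := _ / _.
have sb : 2 * b * s = N ^+ 2 + 1 by rewrite /s mulrC divfK// mulf_neq0.
have -> : complex.Im (chi h + s *i) = b + s by rewrite /b; case: (chi h).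
have := sqr_ge0 (complex.Re (chi h + s *i)); have := sqr_ge0 b; nra.
Qed.

(** The self-adjoint elements x + star x and i (x - star x) have real values,
which gives the imaginary and the real part of the identity. *)
Lemma functional_star chi x : multiplicative_functional chi ->
  chi (star x) = (chi x)^*.
Proof.
move=> chiM.
have := @functional_self_adjoint chi (x + star x) chiM.
rewrite (starD sA) (starK sA) addrC functionalD// => /(_ erefl).
have := @functional_self_adjoint chi ('i%C *: (x - star x)) chiM.
have conji : ('i%C : R[i])^* = - 'i%C.
  by apply/eqP; rewrite eq_complex /= oppr0 !eqxx.
rewrite (starZ sA) (starD sA) starN (starK sA)
  conji scaleNr -scalerN opprD opprK.
rewrite (addrC (- _)) => /(_ erefl).
rewrite functionalZ// functionalB//.
case: (chi x) (chi (star x)) => [a b] [a' b'] /= h1 h2.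
by apply/eqP; rewrite eq_complex /=; apply/andP; split; apply/eqP; lra.
Qed.

Lemma cstar_embedding : separable_Delta A -> linf_embeddable_cstar star.
Proof.
move=> /(separable_isometric_eval cstar_uniform)[phi [phiI phiH _ phiM]].
exists phi; split=> // a; apply: linfE => n.
exact: functional_star a (phiM n).
Qed.

(** ** One instance of the continuous functional calculus *)

(** The element h p(h): p(h) alone would need a unit. *)
Definition mul_peval h (p : {poly R}) : A :=
  \sum_(i < size p) (p`_i)%:C *: iter i (amul h) h.

Lemma functional_mul_peval chi h p (t : R) : multiplicative_functional chi ->
  chi h = t%:C -> chi (mul_peval h p) = (t * p.[t])%:C.
Proof.
move=> chiM ht; rewrite /mul_peval functional_sum//
  horner_coef mulr_sumr rmorph_sum.
apply: eq_bigr => i _; rewrite functionalZ// functional_iter// ht.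
by rewrite !rmorphM/= rmorphXn/=; ring.
Qed.

Lemma functional_real chi h : multiplicative_functional chi -> star h = h ->
  chi h = (complex.Re (chi h))%:C.
Proof.
move=> chiM /(functional_self_adjoint chiM).
by case: (chi h) => a b /= ->.
Qed.

Lemma functional_Re_le chi h : multiplicative_functional chi ->
  `|complex.Re (chi h)| <= nrm h.
Proof.
by move=> /functional_contractive H; apply: le_trans (nrm_Re _) (H h).
Qed.

(** The norm is attained at a character, and characters send h into the real
interval of radius |h|; so uniform closeness of polynomials there is closeness
in A. *)
Lemma mul_peval_le h p q (B : R) : star h = h -> 0 <= B ->
  (forall t, `|t| <= nrm h -> `|t * p.[t] - t * q.[t]| <= B) ->
  nrm (mul_peval h p - mul_peval h q) <= B.
Proof.
move=> hs B0 pq; set z := _ - _.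
have [->|z0] := eqVneq z 0; first by rewrite nrm0.
have [chi /Delta_functional chiM <-] :=
  uniform_norm_attained abA cstar_uniform z0.
have hE := functional_real chiM hs.
rewrite functionalB// !(functional_mul_peval _ chiM hE) -rmorphB nrmR.
by apply: pq; exact: functional_Re_le.
Qed.

(** y is the image of h under t |-> t ((t - c) + |t - c|), a function that
vanishes at 0 and for t <= c.  It is the limit of the elements h (p_n)(h)
with p_n(t) = (t - c) + q_n(t - c), where q_n approximates the absolute value.
Quantifying over all multiplicative functionals covers the coordinates of an
embedding before they are known to be dense. *)
Lemma cstar_positive_part h (c : R) : star h = h ->
  exists y, forall chi, multiplicative_functional chi ->
    let t := complex.Re (chi h) in chi y = (t * ((t - c) + `|t - c|))%:C.
Proof.
move=> hs; pose N := nrm h; have N0 : 0 <= N by exact: nrm_ge0.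
pose L := N + `|c| + 1.
have L0 : 0 < L by have := normr_ge0 c; rewrite /L; lra.
have [q qL] := abs_poly_approx L0.
pose p n := ('X - c%:P) + (q n \Po ('X - c%:P)).
pose d n : R := 2 * L / n.+1%:R.
have pE n t : (p n).[t] = (t - c) + (q n).[t - c].
  by rewrite /p hornerD horner_comp hornerXsubC.
have pd n t : `|t| <= N ->
    `|t * (p n).[t] - t * ((t - c) + `|t - c|)| <= N * d n.
  move=> tN; rewrite pE -mulrBr opprD addrACA subrr add0r normrM ler_pM//.
  apply: qL; apply: le_trans (ler_normB _ _) _; rewrite /L.
  by have := normr_ge0 c; lra.
have d_anti n k : d (n + k)%N <= d n.
  rewrite /d ler_wpM2l//; first by lra.
  by rewrite lef_pV2 ?posrE ?ltr0Sn// ler_nat ltnS leq_addr.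
have d0 n : 0 <= d n by rewrite /d divr_ge0//; lra.
have d_small C e : 0 <= C -> 0 < e -> exists n, C * d n < e.
  move=> C0 e0; exists (Num.truncn (C * (2 * L) / e)).
  rewrite /d mulrA ltr_pdivrMr ?ltr0Sn// -ltr_pdivrMl// mulrC.
  exact: truncnS_gt.
have [||y yl] := @nrm_cauchy_limit _ A (fun n => mul_peval h (p n))
  (fun n => 2 * N * d n).
- move=> n k; apply: mul_peval_le => //.
    by apply: mulr_ge0 => //; exact: mulr_ge0.
  move=> t tN; have := pd n t tN; have := pd (n + k)%N t tN.
  set v := t * (_ + `|_|); have := d_anti n k; set d1 := d _; set d2 := d _.
  move=> d12 h1 h2; rewrite -(subrKA v); apply: le_trans (ler_normD _ _) _.
  by rewrite (distrC v); nra.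
- by move=> e; apply: d_small; rewrite mulr_ge0.
exists y => chi chiM t; apply/subr0_eq/nrm_eq0/le_anti; rewrite nrm_ge0 andbT.
apply/ler_addgt0Pr => e e0; rewrite add0r.
have [|n dn] := d_small (3 * N) e _ e0; first by rewrite mulr_ge0.
apply: le_trans (ltW dn).
have hE := functional_real chiM hs; rewrite -/t in hE.
have := functional_contractive chiM (y - mul_peval h (p n)).
rewrite functionalB// (functional_mul_peval _ chiM hE) => hn.
have h1 := le_trans hn (yl n).
rewrite -(subrKA ((t * (p n).[t])%:C)); apply: le_trans (nrmD _ _) _.
rewrite -rmorphB nrmR; have := pd n t (functional_Re_le h chiM).
by have := h1; lra.
Qed.

End Cstar.

(** * Embeddability implies separability *)

Section Converse.
Variables (R : realType) (A : banachAlgebraType R).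

(** The filter generated by the basic sets around psi converges to psi at every
point, hence in the product topology, so it contains each neighborhood. *)
Lemma ptws_nbhs_basis (psi : A -> R[i]) (O : set {ptws A -> R[i]}) :
  nbhs (psi : {ptws A -> R[i]}) O -> exists (s : seq A) (e : R), 0 < e /\
    forall f : A -> R[i], (forall a, a \in s -> nrm (f a - psi a) < e) -> O f.
Proof.
pose D := [set se : seq A * R | 0 < se.2].
pose B (se : seq A * R) : set (A -> R[i]) :=
  [set f | forall a, a \in se.1 -> nrm (f a - psi a) < se.2].
have F : Filter (filter_from D B).
  apply: filter_from_filter; first by exists ([::], 1); rewrite /D/=.
  move=> [s d] [s' d']; rewrite /D/= => d0 d0'.
  exists (s ++ s', Num.min d d'); first by rewrite /= lt_min d0.
  move=> f fs; split=> a /= as_; have := fs a;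
    by rewrite /= mem_cat as_ ?orbT => /(_ isT); rewrite lt_min => /andP[].
have cvg_psi : {ptws, filter_from D B --> psi}.
  apply/pointwise_cvgP => a; apply/cvgrPdist_lt => e e0.
  have eE : e = (complex.Re e)%:C by rewrite RRe_real// gtr0_real.
  exists ([:: a], complex.Re e); first by rewrite /D/= -ltcR -eE.
  move=> f /= /(_ a); rewrite mem_seq1 eqxx => /(_ isT).
  by rewrite nrmE eE ltcR -nrmN opprB.
by move=> /cvg_psi[[s e] e0 BO]; exists s, e; split=> // f; exact: BO.
Qed.

Lemma le_big_seq (s : seq A) (F : A -> R) a : (forall b, 0 <= F b) ->
  a \in s -> F a <= \sum_(b <- s) F b.
Proof.
by move=> F0 sa; rewrite (big_rem a)//= lerDl sumr_ge0.
Qed.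

Variable star : A -> A.
Hypotheses (abA : abelian_algebra A) (sA : cstar_involution star).

Lemma self_adjoint_witness psi : Delta A psi ->
  exists2 u, star u = u & psi u = 1.
Proof.
move=> [lin mul [a a0]]; have psiM : multiplicative_functional psi by [].
pose v := star a ** a.
have vE : psi v = (nrm (psi a) ^+ 2)%:C.
  by rewrite /v mul (functional_star abA sA)// rmorphXn/= -nrmE normCK mulrC.
exists (((nrm (psi a) ^+ 2)^-1)%:C *: v).
  by rewrite (starZR sA) /v (starM sA) (starK sA).
rewrite functionalZ// vE -rmorphM mulVf//.
by rewrite expf_neq0//; apply: contra_neq a0 => /nrm_eq0.
Qed.

(** With u self-adjoint, psi u = 1 and c_a = a - psi(a) u, the element
h = 2 u - u^2 - sum_a c_a^* c_a plays the role of
1 - (1 - u)^2 - sum_a |c_a|^2 while staying in A.  A functional at distance at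
least e from psi at some a cannot make both 1 - u and c_a small, because
chi a - psi a = chi c_a - psi a (1 - chi u). *)
Lemma peak_element psi (s : seq A) (e : R) : Delta A psi -> 0 < e ->
  exists h eta, [/\ star h = h, psi h = 1, 0 < eta <= 1 &
    forall chi, multiplicative_functional chi ->
      (forall a, a \in s -> nrm (chi a - psi a) < e) \/
        complex.Re (chi h) <= 1 - eta].
Proof.
move=> psiD e0; have psiM := Delta_functional psiD.
have [u us psiu] := self_adjoint_witness psiD.
pose c a := a - psi a *: u.
pose g := u ** u + \sum_(a <- s) star (c a) ** c a.
pose h := 2%:C *: u - g.
(* K bounds all |psi a| for a in s. *)
pose K : R := 1 + \sum_(a <- s) nrm a.
have K1 : 1 <= K by rewrite lerDl sumr_ge0// => a _; exact: nrm_ge0.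
pose eta := Num.min 1 ((e / (2 * K)) ^+ 2).
have chi_h chi : multiplicative_functional chi -> chi h =
    (1 - (1 - complex.Re (chi u)) ^+ 2 - \sum_(a <- s) nrm (chi (c a)) ^+ 2)%:C.
  move=> chiM; have uE := functional_real abA sA chiM us.
  rewrite functionalB// functionalZ// functionalD// chiM.2 functional_sum//.
  rewrite (eq_bigr (fun a => (nrm (chi (c a)) ^+ 2)%:C)); last first.
    by move=> a _; rewrite chiM.2 (functional_star abA sA)//
      rmorphXn/= -nrmE normCK mulrC.
  rewrite -rmorph_sum uE /=; set x := complex.Re _.
  by rewrite -!rmorphM -rmorphD -rmorphB; congr (_%:C); ring.
exists h, eta; split.
- rewrite /h (starD sA) (starN sA) (starZR sA) us /g (starD sA) (starM sA) us.
  congr (_ - (_ + _)).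
  elim: (s) => [|a s' IH]; last first.
    by rewrite !big_cons (starD sA) IH (starM sA) (starK sA).
  by rewrite big_nil -(scale0r 0) (starZ sA) rmorph0 !scale0r.
- rewrite chi_h// psiu /= subrr expr0n/= subr0.
  rewrite big1 ?subr0// => a _.
  by rewrite functionalB// functionalZ// psiu mulr1 subrr nrm0 expr0n.
- rewrite lt_min ltr01 exprn_gt0/= ?ge_min ?lexx// divr_gt0//; lra.
move=> chi chiM.
have [|/existsNP[a /not_implyP[sa /negP]]] :=
  pselect (forall a, a \in s -> nrm (chi a - psi a) < e); first by left.
rewrite -leNgt => ea; right.
rewrite chi_h//=; set x := complex.Re _.
have uE := functional_real abA sA chiM us.
have : nrm (chi (c a)) ^+ 2 <= \sum_(b <- s) nrm (chi (c b)) ^+ 2.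
  by apply: (@le_big_seq s (fun b => nrm (chi (c b)) ^+ 2)) => // b;
    exact: sqr_ge0.
have aK : nrm (psi a) <= K.
  apply: le_trans (functional_contractive psiM a) _.
  have := @le_big_seq s (@nrm R A) a (@nrm_ge0 R A) sa; rewrite /K; lra.
have : e <= nrm (chi (c a)) + K * `|1 - x|.
  apply: le_trans ea _.
  have -> : chi a - psi a = chi (c a) + psi a * (x - 1)%:C.
    by rewrite functionalB// functionalZ// uE rmorphB; ring.
  apply: le_trans (nrmD _ _) _; rewrite lerD2l nrmM nrmR distrC.
  by rewrite ler_wpM2r.
set z := nrm _; set S := \sum_(b <- s) _ => ez zS.
have z0 : 0 <= z by exact: nrm_ge0.
have w0 := normr_ge0 (1 - x).
have -> : (1 - x) ^+ 2 = `|1 - x| ^+ 2 by rewrite -normrX ger0_norm ?sqr_ge0.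
set w := `|1 - x| in w0 ez *.
pose k := e / (2 * K).
have kE : e = 2 * K * k by rewrite /k mulrC divfK// gt_eqF//; lra.
have k0 : 0 < k by rewrite /k divr_gt0//; lra.
have eta_le : eta <= k ^+ 2 by rewrite ge_min lexx orbT.
have zw : k <= z \/ k <= w.
  have [kz|zk] := leP k z; [by left|right].
  by rewrite leNgt; apply/negP => wk; nra.
by case: zw => kk; nra.
Qed.

(** The coordinates of phi that do not vanish identically form the countable
set.  If none of them meets a basic neighborhood of psi, the element y below
has phi y = 0 and psi y = 2 eta. *)
Lemma cstar_converse : linf_embeddable_cstar star -> separable_Delta A.
Proof.
move=> [phi [phiI [phiL phiM] _]].
pose chi n a := phi a n.
have chiM n : multiplicative_functional (chi n).
  by split=> [c x y|x y]; rewrite /chi ?phiL ?phiM.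
exists [set x : set_type (Delta A) | exists n, (set_val x : A -> R[i]) = chi n].
split.
  apply/countable_injP.
  pose f (x : set_type (Delta A)) : nat :=
    match pselect (exists n, (set_val x : A -> R[i]) = chi n) with
    | left h => sval (cid h) | right _ => 0%N end.
  exists f => x y /set_mem[n xn] /set_mem[m ym]; rewrite /f.
  case: pselect => [hx|[]]; last by exists n.
  case: pselect => [hy|[]]; last by exists m.
  case: cid => i xi; case: cid => j yj /= ij.
  by apply/val_inj; rewrite [LHS]xi ij -yj.
move=> O [psi Opsi] Oopen; case: Oopen Opsi => W Wopen <- /= Wpsi.
have psiD : Delta A (set_val psi) by exact: set_valP.
have /ptws_nbhs_basis[s [e [e0 sW]]] : nbhs (set_val psi : {ptws A -> R[i]}) W.
  by apply: open_nbhs_nbhs.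
suff [n chi_n0 chi_near] : exists2 n, exists a, chi n a != 0 &
    forall a, a \in s -> nrm (chi n a - set_val psi a) < e.
  have nD : Delta A (chi n).
    by split=> //; [exact: (chiM n).1|exact: (chiM n).2].
  by exists (SigSub (mem_set nD)); split; [exact: sW|exists n].
apply: contrapT => no_n.
have [h [eta [hs psih /andP[eta0 eta1] h_le]]] := peak_element s psiD e0.
have [y yP] := cstar_positive_part abA sA (1 - eta) hs.
have y0 : y = 0.
  have phi0 : phi 0 = 0.
    by have := phiL (-1) 0 0; rewrite !scaleN1r oppr0 addr0 addNr.
  apply: phiI; rewrite phi0; apply: linfE => n.
  rewrite -[LHS]/(chi n y) yP// /=.
  (* A coordinate near psi vanishes identically by no_n, and 0 <= 1 - eta. *)
  have t_le : complex.Re (chi n h) <= 1 - eta \/ complex.Re (chi n h) = 0.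
    have [|] := h_le _ (chiM n); last by left.
    move=> near_n; right; apply/eqP/negPn/negP => t0; apply: no_n;
      exists n => //.
    by exists h; apply: contra_neq t0 => ->.
  have -> : `|complex.Re (chi n h) - (1 - eta)| =
      (1 - eta) - complex.Re (chi n h).
    by rewrite ler0_norm ?opprB//; lra.
  by rewrite addrA subrK subrr mulr0.
have := yP _ (Delta_functional psiD); rewrite y0 functional0;
  last exact: Delta_functional.
rewrite psih /= => /complexI; rewrite mul1r ger0_norm; lra.
Qed.

End Converse.

Theorem lemma2p1 (R : realType) (A : banachAlgebraType R)
    (abA : abelian_algebra A) :
  [/\ uniform_algebra A -> separable_Delta A -> linf_embeddable_uniform A,
      forall star : A -> A, cstar_involution star ->
        separable_Delta A -> linf_embeddable_cstar star
    & forall star : A -> A, cstar_involution star ->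
        linf_embeddable_cstar star -> separable_Delta A].
Proof.
split.
- by move=> uA /(separable_isometric_eval uA)[phi [phiI phiH phiN _]];
  exists phi.
- by move=> star sA; exact: cstar_embedding abA sA.
- by move=> star sA; exact: cstar_converse abA sA.
Qed.
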